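(* Let $H$ be a hypersemigroup. Then $H$ is regular if and only if both of the following hold: (i) every right ideal of $H$ and every left ideal of $H$ is idempotent; and (ii) for every right ideal $A$ of $H$ and every left ideal $B$ of $H$, the product $A*B$ is a quasi-ideal of $H$.
   Context: For a set $H$, let $\mathcal{P}^*(H)$ denote the set of nonempty subsets of $H$. A hypergroupoid is a nonempty set $H$ with a hyperoperation $\circ : H\times H \to \mathcal{P}^*(H)$, $(a,b)\mapsto a\circ b$, together with the induced operation $*$ on $\mathcal{P}^*(H)$ given by $A*B=\bigcup_{(a,b)\in A\times B}(a\circ b)$ for $A,B\in\mathcal{P}^*(H)$. A hypersemigroup is a hypergroupoid $H$ such that $\{x\}*(y\circ z)=(x\circ y)*\{z\}$ for all $x,y,z\in H$. In a hypersemigroup the operation $*$ on $\mathcal{P}^*(H)$ is associative, so one writes $A*B*C$ for $(A*B)*C=A*(B*C)$. A nonempty subset $A$ of $H$ is a left ideal of $H$ if $H*A\subseteq A$, and a right ideal of $H$ if $A*H\subseteq A$. A nonempty subset $A$ of $H$ is idempotent if $A=A*A$. A hypersemigroup $H$ is regular if $A\subseteq A*H*A$ for every $A\in\mathcal{P}^*(H)$. A nonempty subset $Q$ of $H$ is a quasi-ideal of $H$ if $(Q*H)\cap(H*Q)\subseteq Q$. *)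

(* Defs.v *)
From mathcomp Require Import all_boot.
From mathcomp Require Import boolp classical_sets.

Set Implicit Arguments.
Unset Strict Implicit.
Unset Printing Implicit Defensive.

Local Open Scope classical_set_scope.

(* P^*(H) is represented by [set H] together with the predicate [A !=set0]. *)
Record hypergroupoid := Hypergroupoid {
  hcarrier :> Type;
  hop : hcarrier -> hcarrier -> set hcarrier;
  hcarrier_nonempty : inhabited hcarrier;
  hop_nonempty : forall a b : hcarrier, hop a b !=set0 }.

Definition hmul (H : hypergroupoid) (A B : set H) : set H :=
  \bigcup_(p in A `*` B) hop p.1 p.2.

Declare Scope hyper_scope.
Delimit Scope hyper_scope with hyper.
Notation "A ** B" := (hmul A B) (at level 40, left associativity) : hyper_scope.
Local Open Scope hyper_scope.

Record hypersemigroup := Hypersemigroup {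
  hgroupoid :> hypergroupoid;
  hop_assoc : forall x y z : hgroupoid,
    [set x] ** hop y z = hop x y ** [set z] }.

Section Notions.
Variable H : hypergroupoid.
Implicit Types A Q : set H.

Definition left_ideal A := A !=set0 /\ setT ** A `<=` A.

Definition right_ideal A := A !=set0 /\ A ** setT `<=` A.

Definition hidempotent A := A !=set0 /\ A = A ** A.

Definition quasi_ideal Q :=
  Q !=set0 /\ (Q ** setT) `&` (setT ** Q) `<=` Q.

End Notions.

(* The triple product A * H * A is read as (A * H) * A; for a hypersemigroup
   the bracketing is immaterial. *)
Definition hregular (H : hypersemigroup) :=
  forall A : set H, A !=set0 -> A `<=` A ** setT ** A.

(* Main.v *)
Require Import Defs.
From mathcomp Require Import all_boot.
From mathcomp Require Import boolp classical_sets.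
Local Open Scope classical_set_scope.
Local Open Scope hyper_scope.

(** Write [H] for the whole carrier [setT], and juxtaposition for [**].

    If [H] is regular, a right ideal [A] satisfies [A <= A H A <= A A], so it is
    idempotent, and dually for left ideals. Moreover a right ideal [A] and a
    left ideal [B] satisfy [A `&` B <= A B], as one sees by applying regularity
    to [A `&` B]. Since [(A B) H <= A] and [H (A B) <= B], this makes
    [A B] a quasi-ideal.

    Conversely, let [A] be nonempty. Idempotence of the right ideal [A `|` A H]
    generated by [A] gives [A <= A H], hence also
    [A <= A H = (A H) (A H)]; dually [A <= H A = (H A) (H A)]
    ([sub_mulr], [sub_mull]). Put [Q = (A H) (H A)]. Replacing
    the inner [A] of [(A H) (A H)] by [H A] gives [A <= Q H], and replacing
    the inner [A] of [(H A) (H A)] by [A H] gives [A <= H Q]. As [Q] is the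
    product of a right ideal and a left ideal, it is a quasi-ideal, so
    [A <= Q <= A H A]. *)

Section Products.
Variable H : hypergroupoid.
Implicit Types A B C D : set H.

Lemma hmulP A B x : (A ** B) x <-> exists a b, [/\ A a, B b & hop a b x].
Proof.
split; first by case=> -[a b] /= [Aa Bb] abx; exists a, b.
by case=> a [b [Aa Bb abx]]; exists (a, b).
Qed.

Lemma hmulSS A B C D : A `<=` C -> B `<=` D -> A ** B `<=` C ** D.
Proof.
move=> AC BD x /hmulP[a [b [Aa Bb abx]]].
by apply/hmulP; exists a, b; split; [exact: AC | exact: BD |].
Qed.

Lemma hmul_nonempty A B : A !=set0 -> B !=set0 -> A ** B !=set0.
Proof.
move=> [a Aa] [b Bb]; have [x abx] := hop_nonempty a b.
by exists x; apply/hmulP; exists a, b.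
Qed.

Lemma hsetT_nonempty : [set: H] !=set0.
Proof. by case: (hcarrier_nonempty H) => x; exists x. Qed.

End Products.

(** The associativity axiom only speaks of points; a product of subsets is the
    union of the products of their points, so it extends to subsets. *)
Lemma hmulA (H : hypersemigroup) (A B C : set H) : A ** (B ** C) = A ** B ** C.
Proof.
apply/seteqP; split=> x.
- move=> /hmulP[a [u [Aa /hmulP[b [c [Bb Cc bcu]]] aux]]].
  have : ([set a] ** hop b c) x by apply/hmulP; exists a, u.
  rewrite hop_assoc => /hmulP[v [_ [abv -> vcx]]].
  by apply/hmulP; exists v, c; split=> //; apply/hmulP; exists a, b.
- move=> /hmulP[u [c [/hmulP[a [b [Aa Bb abu]]] Cc ucx]]].
  have : (hop a b ** [set c]) x by apply/hmulP; exists u, c.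
  rewrite -hop_assoc => /hmulP[_ [v [-> bcv avx]]].
  by apply/hmulP; exists a, v; split=> //; apply/hmulP; exists b, c.
Qed.

Section Ideals.
Variable H : hypersemigroup.
Implicit Types A B : set H.

Lemma right_ideal_mulT A : A !=set0 -> right_ideal (A ** setT).
Proof.
move=> A0; split; first exact/hmul_nonempty/hsetT_nonempty.
by rewrite -hmulA; apply: hmulSS.
Qed.

Lemma left_ideal_mulT A : A !=set0 -> left_ideal (setT ** A).
Proof.
move=> A0; split; first by apply: hmul_nonempty => //; exact: hsetT_nonempty.
by rewrite hmulA; apply: hmulSS.
Qed.

Lemma right_ideal_gen A : A !=set0 -> right_ideal (A `|` A ** setT).
Proof.
move=> A0; split; first by case: A0 => a Aa; exists a; left.
move=> x /hmulP[a [b [[Aa|AHa] _ abx]]]; right; first by apply/hmulP; exists a, b.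
by apply: (right_ideal_mulT _ A0).2; apply/hmulP; exists a, b.
Qed.

Lemma left_ideal_gen A : A !=set0 -> left_ideal (A `|` setT ** A).
Proof.
move=> A0; split; first by case: A0 => a Aa; exists a; left.
move=> x /hmulP[a [b [_ [Ab|HAb] abx]]]; right; first by apply/hmulP; exists a, b.
by apply: (left_ideal_mulT _ A0).2; apply/hmulP; exists a, b.
Qed.

(** With [R = A `|` A H], one has [A <= R = R R <= R H], and both [A H] and
    [(A H) H] lie in [A H]. *)
Lemma sub_mulr A : (forall R : set H, right_ideal R -> hidempotent R) ->
  A !=set0 -> A `<=` A ** setT.
Proof.
move=> idem A0 x Ax; have [_ RR] := idem _ (right_ideal_gen _ A0).
have : (A `|` A ** setT) x by left.
rewrite RR => /hmulP[a [b [[Aa|AHa] _ abx]]]; first by apply/hmulP; exists a, b.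
by apply: (right_ideal_mulT _ A0).2; apply/hmulP; exists a, b.
Qed.

Lemma sub_mull A : (forall L : set H, left_ideal L -> hidempotent L) ->
  A !=set0 -> A `<=` setT ** A.
Proof.
move=> idem A0 x Ax; have [_ LL] := idem _ (left_ideal_gen _ A0).
have : (A `|` setT ** A) x by left.
rewrite LL => /hmulP[a [b [_ [Ab|HAb] abx]]]; first by apply/hmulP; exists a, b.
by apply: (left_ideal_mulT _ A0).2; apply/hmulP; exists a, b.
Qed.

Lemma regular_right_idempotent A :
  hregular H -> right_ideal A -> hidempotent A.
Proof.
move=> reg [A0 AH]; split=> //; apply/seteqP; split.
- by apply: subset_trans (reg A A0) _; apply: hmulSS.
- by apply: subset_trans AH; apply: hmulSS.
Qed.

Lemma regular_left_idempotent B :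
  hregular H -> left_ideal B -> hidempotent B.
Proof.
move=> reg [B0 HB]; split=> //; apply/seteqP; split.
- by apply: subset_trans (reg B B0) _; rewrite -hmulA; apply: hmulSS.
- by apply: subset_trans HB; apply: hmulSS.
Qed.

(** Apply regularity to [A `&` B], using [A] on the left and [B] on the right:
    [A `&` B <= A H B <= A B]. *)
Lemma regular_setI_sub_mul A B :
  hregular H -> right_ideal A -> A `&` B `<=` A ** B.
Proof.
move=> reg [_ AH] x ABx.
have : ((A `&` B) ** setT ** (A `&` B)) x by apply: reg => //; exists x.
apply: hmulSS; last by move=> y [].
by apply: subset_trans AH; apply: hmulSS => // y [].
Qed.

Lemma regular_mul_quasi_ideal A B :
  hregular H -> right_ideal A -> left_ideal B -> quasi_ideal (A ** B).
Proof.
move=> reg rA lB; have [[A0 AH] [B0 HB]] := (rA, lB).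
split; first exact: hmul_nonempty.
move=> x [ABHx HABx]; apply: regular_setI_sub_mul => //; split.
- by apply: AH; move: ABHx; rewrite -hmulA; apply: hmulSS.
- by apply: HB; move: HABx; rewrite hmulA; apply: hmulSS.
Qed.

Lemma ideals_regular :
  (forall A : set H, right_ideal A -> hidempotent A) ->
  (forall B : set H, left_ideal B -> hidempotent B) ->
  (forall A B : set H, right_ideal A -> left_ideal B -> quasi_ideal (A ** B)) ->
  hregular H.
Proof.
move=> idR idL quasi A A0.
have AAH := sub_mulr _ idR A0; have AHA := sub_mull _ idL A0.
have rAH := right_ideal_mulT _ A0; have lHA := left_ideal_mulT _ A0.
have [_ AH2] := idR _ rAH; have [_ HA2] := idL _ lHA.
have [_ Qquasi] := quasi _ _ rAH lHA.
have AQ : A `<=` A ** setT ** (setT ** A).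
  move=> x Ax; apply: Qquasi; split.
  - (* [(A H) (A H) <= (A H) ((H A) H) = Q H] *)
    have := AAH x Ax; rewrite [X in X x -> _]AH2 -[X in _ -> X x]hmulA.
    by apply: hmulSS => //; apply: hmulSS.
  - (* [(H A) (H A) <= (H (A H)) (H A) = H Q] *)
    have := AHA x Ax; rewrite [X in X x -> _]HA2 [X in _ -> X x]hmulA.
    by apply: hmulSS => //; apply: hmulSS.
by apply: subset_trans AQ _; rewrite hmulA; apply: hmulSS => //; exact: rAH.2.
Qed.

End Ideals.

Theorem theorem12 (H : hypersemigroup) :
  hregular H <->
  ((forall A : set H, right_ideal A -> hidempotent A) /\
   (forall B : set H, left_ideal B -> hidempotent B)) /\
  (forall A B : set H, right_ideal A -> left_ideal B -> quasi_ideal (A ** B)).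
Proof.
split=> [reg | [[idR idL] quasi]]; last exact: ideals_regular.
split; last by move=> A B; exact: regular_mul_quasi_ideal.
by split=> A; [exact: regular_right_idempotent | exact: regular_left_idempotent].
Qed.
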